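(* Let $1\le p<\infty$ and let $X$ be a Banach space. Every $p$-Right subset of $X^{*}$ is a $p$-Right$^{*}$ set in $X^{*}$ if and only if, for every Banach space $Y$ and every Dunford-Pettis $p$-convergent operator $T:X\to Y$, the second adjoint $T^{**}:X^{**}\to Y^{**}$ is a Dunford-Pettis $p$-convergent operator.
   Context: ''Operator'' means bounded linear operator. A sequence $(x_n)_n$ in a Banach space $X$ is weakly $p$-summable if $(x^{*}(x_n))_n\in\ell_p$ for every $x^{*}\in X^{*}$. A bounded subset $K\subseteq X$ is a Dunford-Pettis set if every weakly null sequence $(x_n^{*})_n$ in $X^{*}$ converges to zero uniformly on $K$. A sequence in $X$ is called $p$-Right null if it is weakly $p$-summable and its set of terms is a Dunford-Pettis set. An operator $T:X\to Y$ is Dunford-Pettis $p$-convergent if $\|T(x_n)\|\to 0$ for every $p$-Right null sequence $(x_n)_n$ in $X$. A bounded subset $K\subseteq X^{*}$ is a $p$-Right set if $\lim_n\sup_{x^{*}\in K}|x^{*}(x_n)|=0$ for every $p$-Right null sequence $(x_n)_n$ in $X$. A bounded subset $K$ of a Banach space $Z$ is a $p$-Right$^{*}$ set in $Z$ if $\lim_n\sup_{z\in K}|z_n^{*}(z)|=0$ for every $p$-Right null sequence $(z_n^{*})_n$ in $Z^{*}$ (here applied to $Z=X^{*}$). *)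

(* Defs.v *)
From HB Require Import structures.
From mathcomp Require Import all_boot all_order all_algebra.
From mathcomp Require Import all_classical all_reals all_analysis.
From mathcomp Require Import complex.

Set Implicit Arguments.
Unset Strict Implicit.
Unset Printing Implicit Defensive.

Import Order.TTheory GRing.Theory Num.Theory.
Import numFieldNormedType.Exports.

Local Open Scope classical_set_scope.
Local Open Scope ring_scope.

(* Banach spaces are real or complex; every notion below is stated once for
   both cases. Norms of a [normedModType K] take their values in [K], so over
   the complex numbers they are complex numbers lying on the nonnegative real
   half-line, and the partial order of [complex R] restricts there to the
   order of [R]. *)
Variant scalars := real_scalars | complex_scalars.

Definition scalar_field (R : realType) (s : scalars) : numFieldType :=
  match s with
  | real_scalars => R
  | complex_scalars => complex R
  end.

Definition abs_val (R : realType) (s : scalars) : scalar_field R s -> R :=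
  match s return scalar_field R s -> R with
  | real_scalars => fun z : R => `|z|
  | complex_scalars => fun z : complex R => complex.Re `|z|
  end.

Section Supremum.
Context (R : realType) (s : scalars).
Local Notation K := (scalar_field R s).

Lemma scalar_supremum_lub (A : set K) : A !=set0 -> (forall x, A x -> 0 <= x) ->
  ubound A !=set0 -> isLub A (supremum 0 A).
Proof.
move=> A0 Age0 Aub.
suff [m mP] : exists m, isLub A m.
  rewrite /supremum; case: ifPn => [/eqP A00|_].
    by case: A0 => x; rewrite A00.
  by case: xgetP => [y yE [? ?]|/(_ m)] //; case.
case: s A A0 Age0 Aub => /= A [a Aa] Age0 [u uA].
  exists (reals.sup A); split.
    by move=> x Ax; apply: ub_le_sup => //; exists u.
  by move=> b bA; apply: ge_sup => //; exists a.
have ReA x : A x -> x = real_complex R (complex.Re x).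
  by move=> /Age0/ger0_real/RRe_real ->.
have supA : has_sup [set complex.Re x | x in A].
  split; first by exists (complex.Re a), a.
  by exists (complex.Re u) => _ [x Ax <-]; have := uA _ Ax; rewrite lecE => /andP[].
exists (real_complex R (reals.sup [set complex.Re x | x in A])); split.
  move=> x Ax; rewrite (ReA _ Ax) lecR.
  by apply: ub_le_sup; [case: supA|exists x].
move=> b bA; rewrite lecE /=; apply/andP; split.
  have := bA _ Aa; rewrite (ReA _ Aa) lecE /=.
  by case/andP.
apply: ge_sup; first by case: supA.
by move=> _ [x Ax <-]; have := bA _ Ax; rewrite lecE => /andP[].
Qed.

End Supremum.

Section BoundedOperators.
Context (R : realType) (s : scalars).
Local Notation K := (scalar_field R s).
Context (X Y : normedModType K).

Definition bounded_linear : {pred X -> Y} := fun T =>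
  `[< linear T /\ exists M : K, forall x, `|T x| <= M * `|x| >].

Record operator :=
  Operator { op_val :> X -> Y; op_valP : op_val \in bounded_linear }.

HB.instance Definition _ := [isSub for op_val].
HB.instance Definition _ := [Choice of operator by <:].

Lemma bounded_linear_submod : submod_closed bounded_linear.
Proof.
split=> [|a T U].
  apply/asboolP; split=> [b x y|]; first by rewrite scaler0 addr0.
  by exists 0 => x; rewrite normr0 mul0r.
move=> /asboolP[linT [M TM]] /asboolP[linU [N UN]].
apply/asboolP; split=> [b x y|].
  rewrite !fctE linT linU !scalerDr !scalerA [b * a]mulrC.
  by rewrite addrACA.
exists (`|a| * M + N) => x; rewrite !fctE mulrDl.
rewrite (le_trans (ler_normD _ _))// lerD// normrZ -mulrA.
by rewrite ler_wpM2l.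
Qed.

HB.instance Definition _ := GRing.isSubmodClosed.Build K (X -> Y)
  bounded_linear bounded_linear_submod.
HB.instance Definition _ := [SubChoice_isSubLmodule of operator by <:].

Lemma operator_linear (T : operator) : linear T.
Proof. by have /asboolP[] := op_valP T. Qed.

HB.instance Definition _ (T : operator) :=
  GRing.isLinear.Build K X Y *:%R (op_val T) (operator_linear T).

Lemma operator_bounded (T : operator) :
  exists M : K, forall x, `|T x| <= M * `|x|.
Proof. by have /asboolP[] := op_valP T. Qed.

Definition op_norm (T : operator) : K :=
  supremum 0 [set `|T x| | x in [set x | `|x| <= 1]].

Lemma op_norm_lub (T : operator) :
  isLub [set `|T x| | x in [set x | `|x| <= 1]] (op_norm T).
Proof.
apply: scalar_supremum_lub.
- by exists `|T 0|, 0 => //=; rewrite normr0.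
- by move=> _ [x _ <-].
- have [M TM] := operator_bounded T.
  exists `|M| => _ [x /= x1 <-].
  have : 0 <= M * `|x| by rewrite (le_trans _ (TM x)).
  move=> Mx0; rewrite (le_trans (TM x))// -(ger0_norm Mx0) normrM normr_id.
  by rewrite ler_piMr.
Qed.

Lemma op_norm_ge0 (T : operator) : 0 <= op_norm T.
Proof.
have [ub _] := op_norm_lub T; apply: le_trans (ub `|T 0| _) => //.
by exists 0 => //=; rewrite normr0.
Qed.

Lemma le_op_norm (T : operator) x : `|T x| <= op_norm T * `|x|.
Proof.
have [->|x0] := eqVneq x 0; first by rewrite linear0 !normr0 mulr0.
have nx0 : 0 < `|x| by rewrite normr_gt0.
have [ub _] := op_norm_lub T.
have /ub : [set `|T x| | x in [set x | `|x| <= 1]] `|T (`|x|^-1 *: x)|.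
  exists (`|x|^-1 *: x) => //=.
  by rewrite normrZ ger0_norm ?invr_ge0// mulVf ?gt_eqF.
by rewrite linearZ normrZ ger0_norm ?invr_ge0// mulrC ler_pdivrMr.
Qed.

Lemma op_norm_le (T : operator) (M : K) : 0 <= M ->
  (forall x, `|T x| <= M * `|x|) -> op_norm T <= M.
Proof.
move=> M0 TM; have [_ lub] := op_norm_lub T; apply: lub => _ [x /= x1 <-].
by rewrite (le_trans (TM x))// ler_piMr.
Qed.

Lemma op_normD (T U : operator) : op_norm (T + U) <= op_norm T + op_norm U.
Proof.
apply: op_norm_le => [|x]; first by rewrite addr_ge0 ?op_norm_ge0.
by rewrite (le_trans (ler_normD _ _))// mulrDl lerD ?le_op_norm.
Qed.

Let op_normZ_le (a : K) (T : operator) : op_norm (a *: T) <= `|a| * op_norm T.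
Proof.
apply: op_norm_le => [|x]; first by rewrite mulr_ge0 ?op_norm_ge0.
have -> : (a *: T) x = a *: T x by [].
by rewrite normrZ -mulrA ler_wpM2l ?le_op_norm.
Qed.

Lemma op_norm0_eq0 (T : operator) : op_norm T = 0 -> T = 0.
Proof.
move=> T0; apply/val_inj/funext => x /=; apply/eqP.
by rewrite -normr_le0 -(mul0r `|x|) -T0 le_op_norm.
Qed.

Lemma op_normZ (a : K) (T : operator) : op_norm (a *: T) = `|a| * op_norm T.
Proof.
apply/eqP; rewrite eq_le op_normZ_le /=.
have [->|a0] := eqVneq a 0; first by rewrite normr0 mul0r op_norm_ge0.
rewrite mulrC -ler_pdivlMr ?normr_gt0// -normfV mulrC.
by rewrite -{1}(scalerK a0 T) op_normZ_le.
Qed.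

HB.instance Definition _ :=
  Lmodule_isNormed.Build K operator op_normD op_normZ op_norm0_eq0.

End BoundedOperators.
Arguments bounded_linear {R s} X Y.

Section Dual.
Context (R : realType) (s : scalars).
Local Notation K := (scalar_field R s).

Definition dual (X : normedModType K) : normedModType K := operator X K^o.

Section Adjoint.
Context (X Y : normedModType K) (T : operator X Y).

Definition adjoint_fun (g : dual Y) (x : X) : K^o := g (T x).

Lemma adjoint_fun_bound (g : dual Y) x :
  `|adjoint_fun g x| <= op_norm g * op_norm T * `|x|.
Proof.
rewrite (le_trans (le_op_norm g _))// -mulrA.
by rewrite ler_wpM2l ?op_norm_ge0 ?le_op_norm.
Qed.

Lemma adjoint_fun_bounded_linear (g : dual Y) :
  adjoint_fun g \in bounded_linear X K^o.
Proof.
apply/asboolP; split=> [a x y|]; last first.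
  by exists (op_norm g * op_norm T) => x; exact: adjoint_fun_bound.
by rewrite /adjoint_fun !linearP.
Qed.

Lemma adjoint_bounded_linear :
  (fun g : dual Y => Operator (adjoint_fun_bounded_linear g) : dual X)
    \in bounded_linear (dual Y) (dual X).
Proof.
apply/asboolP; split=> [a g h|]; first exact/val_inj/funext.
exists (op_norm T) => g; apply: op_norm_le => [|x].
  by rewrite mulr_ge0 ?op_norm_ge0.
by rewrite [_ * `|g|]mulrC; exact: adjoint_fun_bound.
Qed.

Definition adjoint : operator (dual Y) (dual X) :=
  Operator adjoint_bounded_linear.

Lemma adjointE (g : dual Y) (x : X) : adjoint g x = g (T x).
Proof. by []. Qed.

End Adjoint.

Definition weakly_null (X : normedModType K) (x : nat -> X) : Prop :=
  forall f : dual X, f (x n) @[n --> \oo] --> (0 : K^o).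

Definition weakly_summable (p : R) (X : normedModType K) (x : nat -> X) : Prop :=
  forall f : dual X,
    (\sum_(0 <= n <oo) (abs_val (f (x n)) `^ p)%:E < +oo)%E.

Definition Dunford_Pettis_set (X : normedModType K) (A : set X) : Prop :=
  bounded_set A /\
  forall f : nat -> dual X, weakly_null f ->
    {uniform A, (fun n => f n : X -> K^o) @ \oo --> (cst 0 : X -> K^o)}.

Definition Right_null (p : R) (X : normedModType K) (x : nat -> X) : Prop :=
  weakly_summable p x /\ Dunford_Pettis_set (range x).

Definition Dunford_Pettis_convergent (p : R) (X Y : normedModType K)
    (T : operator X Y) : Prop :=
  forall x : nat -> X, Right_null p x -> `|T (x n)| @[n --> \oo] --> (0 : K^o).

(* For the empty set, [supremum 0] is 0; for the other bounded sets [A] it is a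
   genuine least upper bound by [scalar_supremum_lub]. *)
Definition Right_set (p : R) (X : normedModType K) (A : set (dual X)) : Prop :=
  bounded_set A /\
  forall x : nat -> X, Right_null p x ->
    supremum 0 [set `|f (x n)| | f in A] @[n --> \oo] --> (0 : K^o).

Definition Right_star_set (p : R) (Z : normedModType K) (A : set Z) : Prop :=
  bounded_set A /\
  forall f : nat -> dual Z, Right_null p f ->
    supremum 0 [set `|f n z| | z in A] @[n --> \oo] --> (0 : K^o).

End Dual.

(* Main.v *)
Require Import Defs.
From HB Require Import structures.
From mathcomp Require Import all_boot all_order all_algebra.
From mathcomp Require Import all_classical all_reals all_analysis.
From mathcomp Require complex.
From mathcomp Require Import ring.
Import Order.TTheory GRing.Theory Num.Theory.
Import numFieldNormedType.Exports.
Local Open Scope classical_set_scope.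
Local Open Scope ring_scope.

(** Both directions rest on one fact: an adjoint exchanges operators with sets
of functionals. The norm of [T x] dominates [sup |f x|] over [f] in the image
[T^*(B)] of the unit ball [B] of [Y^*], and the norm of [T^** F] is by
definition the supremum of [|F f|] over the same set. So, for an operator [T]
that is Dunford-Pettis p-convergent, [T^*(B)] is a p-Right subset of [X^*]
([adjoint_unit_ball_Right_set]); if it is then a p-Right* set, [T^**] is
Dunford-Pettis p-convergent ([Right_star_image_unit_ball]).

Conversely a bounded subset [A] of [X^*] gives the operator [T : X -> l_oo(A)],
[T x = (f x)_(f in A)]. The norm of [T x] is the supremum of [|f x|] over [A],
so [T] is Dunford-Pettis p-convergent when [A] is a p-Right set
([family_operator_Dunford_Pettis]). Each [f] in [A] is [T^*] of the evaluation
at [f], a functional of norm at most 1 on [l_oo(A)]; hence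
[|F f| <= `|T^** F|] for every [F] in [X^**], and [A] is a p-Right* set as soon
as [T^**] is Dunford-Pettis p-convergent ([Right_star_set_family_operator]).

The space [l_oo(A)] is complete because the scalar field is, be it the real or
the complex numbers ([linfty_cauchy_cvg]). *)

(** * Convergence and boundedness in normed modules *)

Lemma cauchy_normP {K : numFieldType} {V : normedModType K} (F : set_system V)
    (FF : ProperFilter F) :
  cauchy F <-> forall e, 0 < e -> exists u, \forall v \near F, `|u - v| < e.
Proof.
rewrite cauchyP; split=> Fc e e0; have [u Fu] := Fc e e0; exists u;
  by move: Fu; rewrite -?ball_normE.
Qed.

Lemma squeeze_norm0 {K : numFieldType} {V W : normedModType K}
    {T : Type} {F : set_system T} {FF : Filter F} (f : T -> V) (g : T -> W) :
  (forall t, `|f t| <= `|g t|) -> g @ F --> 0 -> f @ F --> 0.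
Proof.
move=> fg /cvgr0Pnorm_lt g0; apply/cvgr0Pnorm_lt => e /g0.
by apply: filterS => t; apply: le_lt_trans.
Qed.

Lemma bounded_setP {K : numFieldType} {V : normedModType K} (A : set V) :
  bounded_set A <-> exists M : K, forall v, A v -> `|v| <= M.
Proof.
split=> [[M [Mr AM]]|[M AM]].
  exists (M + 1) => v Av.
  by apply: AM => //; rewrite ltrDl.
have [[v Av]|A0] := pselect (exists v, A v); last first.
  by exists 0; split=> // N _ v Av; case: A0; exists v.
exists M; split => [|N MN w Aw].
  by rewrite ger0_real// (le_trans _ (AM v Av)).
exact: le_trans (AM _ Aw) (ltW MN).
Qed.

(** * Completeness of the scalar field *)

Section ComplexComplete.
Import complex.
Local Open Scope complex_scope.
Context {R : realType}.
Implicit Types z : R[i].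

Lemma normc_ge_Im z : `|complex.Im z|%:C <= `|z|.
Proof.
by rewrite normc_def lecR -sqrtr_sqr ler_wsqrtr// lerDr sqr_ge0.
Qed.

Lemma normc_le_ReIm z : `|z| <= `|complex.Re z|%:C + `|complex.Im z|%:C.
Proof.
rewrite [in leLHS](complexE z) (le_trans (ler_normD _ _))//.
rewrite normrM !normc_def/= !expr0n/= expr1n.
by rewrite !(add0r, addr0) sqrtr1 mul1r !sqrtr_sqr.
Qed.

(** The real and imaginary parts do not increase norms, so they carry a Cauchy
filter to Cauchy filters on the reals; the two real limits are assembled. *)
Lemma complex_cauchy_cvg (F : set_system R[i]^o) :
  ProperFilter F -> cauchy F -> cvg F.
Proof.
move=> FF; rewrite cauchy_normP => Fc.
have part (h : {additive R[i] -> R}) : (forall z, `|h z|%:C <= `|z|) ->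
    cvg (h z @[z --> F]).
  move=> hle; apply: (@cauchy_cvg R^o); apply/cauchy_normP => e e0.
  have [|a Fa] := Fc e%:C; first by rewrite ltcR.
  exists (h a); apply: (filterS _ Fa) => b ab /=.
  have -> : h a - h b = h (a - b) by rewrite raddfB.
  by rewrite -ltcR; apply: le_lt_trans ab; exact: hle.
pose h1 : {additive R[i] -> R} := @complex.Re R.
pose h2 : {additive R[i] -> R} := @complex.Im R.
have /cvg_ex[/= x /cvgrPdist_lt Fx] := part h1 (@normc_ge_Re _).
have /cvg_ex[/= y /cvgrPdist_lt Fy] := part h2 normc_ge_Im.
apply/cvg_ex; exists (x +i* y); apply/cvgrPdist_lt => e e0.
have eE : e = (complex.Re e)%:C by rewrite RRe_real ?gtr0_real.
have e20 : 0 < complex.Re e / 2 by rewrite divr_gt0// -ltcR -eE.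
near=> z.
apply: le_lt_trans (normc_le_ReIm _) _.
rewrite eE -raddfD ltcR [ltRHS]splitr ltrD//.
  by rewrite raddfB; near: z; apply: Fx.
by rewrite raddfB; near: z; apply: Fy.
Unshelve. all: by end_near. Qed.

End ComplexComplete.

Section ScalarComplete.
Context {R : realType} {s : scalars}.
Local Notation K := (scalar_field R s).

Lemma scalar_cauchy_cvg (F : set_system K^o) :
  ProperFilter F -> cauchy F -> cvg F.
Proof.
by case: s F => F FF; [exact: (@cauchy_cvg R^o)|exact: complex_cauchy_cvg].
Qed.

End ScalarComplete.

(** * Suprema of norms *)

Section NormSupremum.
Context {R : realType} {s : scalars}.
Local Notation K := (scalar_field R s).
Context {T : Type} (h : T -> K^o) (A : set T).

Lemma supremum_norm_le (M : K) : 0 <= M -> (forall t, A t -> `|h t| <= M) ->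
  supremum 0 [set `|h t| | t in A] <= M.
Proof.
move=> M0 hM; set B := [set _ | _ in _].
have [->|B0] := eqVneq B set0; first by rewrite supremum0.
have [|||_] := @scalar_supremum_lub R s B.
- exact/set0P.
- by move=> _ [t _ <-].
- by exists M => _ [t At <-]; exact: hM.
by apply => _ [t At <-]; exact: hM.
Qed.

Lemma le_supremum_norm (M : K) t : (forall t, A t -> `|h t| <= M) -> A t ->
  `|h t| <= supremum 0 [set `|h t| | t in A].
Proof.
move=> hM At; have [|||ub _] := @scalar_supremum_lub R s [set `|h t| | t in A].
- by exists `|h t|, t.
- by move=> _ [u _ <-].
- by exists M => _ [u Au <-]; exact: hM.
by apply: ub; exists t.
Qed.

Lemma supremum_norm_ge0 (M : K) : (forall t, A t -> `|h t| <= M) ->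
  0 <= supremum 0 [set `|h t| | t in A].
Proof.
move=> hM; have [[t At]|A0] := pselect (exists t, A t).
  exact: le_trans (le_supremum_norm M t hM At).
rewrite (_ : A = set0) ?image_set0 ?supremum0//.
by apply/seteqP; split=> // t At; case: A0; exists t.
Qed.

End NormSupremum.

(** * The Banach space of bounded functions *)

Section BoundedFunctions.
Context {R : realType} {s : scalars}.
Local Notation K := (scalar_field R s).
Context (I : Type).

Definition bounded_fun : {pred I -> K^o} := fun u =>
  `[< exists M : K, forall i, `|u i| <= M >].

Record linfty := Linfty { linfty_val :> I -> K^o;
  linfty_valP : linfty_val \in bounded_fun }.

HB.instance Definition _ := [isSub for linfty_val].
HB.instance Definition _ := [Choice of linfty by <:].

Lemma bounded_fun_submod : submod_closed bounded_fun.
Proof.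
split=> [|a u v].
  by apply/asboolP; exists 0 => i; rewrite normr0.
move=> /asboolP[M uM] /asboolP[N vN]; apply/asboolP.
exists (`|a| * M + N) => i; rewrite !fctE.
by rewrite (le_trans (ler_normD _ _))// lerD// normrZ ler_wpM2l.
Qed.

HB.instance Definition _ := GRing.isSubmodClosed.Build K (I -> K^o)
  bounded_fun bounded_fun_submod.
HB.instance Definition _ := [SubChoice_isSubLmodule of linfty by <:].

Definition sup_norm (u : linfty) : K := supremum 0 [set `|u i| | i in setT].

Lemma sup_norm_le (u : linfty) (M : K) :
  0 <= M -> (forall i, `|u i| <= M) -> sup_norm u <= M.
Proof. by move=> M0 uM; apply: supremum_norm_le. Qed.

Lemma le_sup_norm (u : linfty) i : `|u i| <= sup_norm u.
Proof.
have /asboolP[M uM] := linfty_valP u.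
by apply: (@le_supremum_norm _ _ _ _ _ M).
Qed.

Lemma sup_norm_ge0 (u : linfty) : 0 <= sup_norm u.
Proof.
have /asboolP[M uM] := linfty_valP u.
by apply: (@supremum_norm_ge0 _ _ _ _ _ M).
Qed.

Lemma sup_normD (u v : linfty) : sup_norm (u + v) <= sup_norm u + sup_norm v.
Proof.
apply: sup_norm_le => [|i]; first by rewrite addr_ge0 ?sup_norm_ge0.
by rewrite (le_trans (ler_normD _ _))// lerD ?le_sup_norm.
Qed.

Lemma sup_norm0_eq0 (u : linfty) : sup_norm u = 0 -> u = 0.
Proof.
move=> u0; apply/val_inj/funext => i /=; apply/eqP.
by rewrite -normr_le0 -u0 le_sup_norm.
Qed.

Let sup_normZ_le (a : K) (u : linfty) : sup_norm (a *: u) <= `|a| * sup_norm u.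
Proof.
apply: sup_norm_le => [|i]; first by rewrite mulr_ge0 ?sup_norm_ge0.
have -> : (a *: u) i = a *: u i by [].
by rewrite normrZ ler_wpM2l ?le_sup_norm.
Qed.

Lemma sup_normZ (a : K) (u : linfty) : sup_norm (a *: u) = `|a| * sup_norm u.
Proof.
apply/eqP; rewrite eq_le sup_normZ_le /=.
have [->|a0] := eqVneq a 0; first by rewrite normr0 mul0r sup_norm_ge0.
rewrite mulrC -ler_pdivlMr ?normr_gt0// -normfV mulrC.
by rewrite -{1}(scalerK a0 u) sup_normZ_le.
Qed.

HB.instance Definition _ :=
  Lmodule_isNormed.Build K linfty sup_normD sup_normZ sup_norm0_eq0.

(** The limit is taken pointwise. That it is uniform is checked index by index:
the functions [v] and [w] lie in one small ball of the filter, and [w], which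
may depend on the index [i], is moreover close to the limit at [i]. *)
Lemma linfty_cauchy_cvg (F : set_system linfty) :
  ProperFilter F -> cauchy F -> cvg F.
Proof.
move=> FF; rewrite cauchy_normP => Fc.
have Fi i : cvg ((fun u : linfty => u i) @ F).
  apply: scalar_cauchy_cvg; apply/cauchy_normP => e /Fc[u Fu].
  exists (u i); apply: (filterS _ Fu) => v; apply: le_lt_trans.
  exact: le_sup_norm (u - v) i.
pose l i : K^o := lim ((fun u : linfty => u i) @ F).
have Fl e : 0 < e -> F [set u : linfty | forall i, `|l i - u i| <= e].
  move=> e0; have e30 : 0 < e / 3%:R by rewrite divr_gt0.
  have [u Fu] := Fc _ e30.
  apply: (filterS _ Fu) => v uv i.
  have /cvgrPdist_lt/(_ _ e30) Fli := Fi i.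
  have [w [uw lw]] := filter_ex (filterI Fu Fli).
  have -> : l i - v i = (l i - w i) - (u - w) i + (u - v) i.
    by rewrite -[RHS]/(l i - w i - (u i - w i) + (u i - v i)); ring.
  have -> : e = e / 3%:R + e / 3%:R + e / 3%:R by field.
  apply: le_trans (ler_normD _ _) (lerD _ (le_trans (le_sup_norm _ i) (ltW uv))).
  apply: le_trans (ler_normB _ _) _.
  exact: lerD (ltW lw) (le_trans (le_sup_norm _ i) (ltW uw)).
have [u0 Fu0] := filter_ex (Fl 1 ltr01).
have lb : l \in bounded_fun.
  apply/asboolP; exists (1 + `|u0|) => i.
  rewrite -(subrK (u0 i) (l i)) (le_trans (ler_normD _ _))// lerD//.
  exact: le_sup_norm.
apply/cvg_ex; exists (Linfty l lb); apply/cvgrPdist_le => e e0.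
apply: filterS (Fl e e0) => u lu.
by apply: sup_norm_le => //; exact: ltW.
Qed.

HB.instance Definition _ := Uniform_isComplete.Build linfty linfty_cauchy_cvg.

End BoundedFunctions.

Arguments linfty_val {R s I}.
Arguments Linfty {R s I}.

Section Evaluation.
Context {R : realType} {s : scalars}.
Local Notation K := (scalar_field R s).
Context {I : Type}.

Lemma linfty_eval_bounded_linear (i : I) :
  (fun u : linfty I => u i) \in bounded_linear (linfty I : normedModType K) K^o.
Proof.
apply/asboolP; split=> //; exists 1 => u; rewrite mul1r.
exact: (@le_sup_norm R s).
Qed.

Definition linfty_eval (i : I) : dual (linfty I : normedModType K) :=
  Operator (linfty_eval_bounded_linear i).

Lemma linfty_eval_norm (i : I) : `|linfty_eval i| <= 1.
Proof.
apply: op_norm_le => // u; rewrite mul1r; exact: (@le_sup_norm R s).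
Qed.

End Evaluation.

(** * The operator of a bounded family of functionals *)

Section BoundedFamily.
Context {R : realType} {s : scalars}.
Local Notation K := (scalar_field R s).
Context {X : normedModType K} {I : Type} (g : I -> dual X) (M : K)
  (gM : forall i, `|g i| <= M).

Lemma family_val_le i x : `|g i x| <= M * `|x|.
Proof. by rewrite (le_trans (le_op_norm _ _))// ler_wpM2r//; exact: gM. Qed.

Lemma family_val_bounded x : (fun i => g i x) \in bounded_fun I.
Proof. by apply/asboolP; exists (M * `|x|) => i; exact: family_val_le. Qed.

Lemma family_bounded_linear :
  (fun x => Linfty _ (family_val_bounded x))
    \in bounded_linear X (linfty I : normedModType K).
Proof.
apply/asboolP; split=> [a x y|].
  by apply/val_inj/funext => i /=; rewrite linearP.
(* For an empty [I] the hypothesis leaves [M] arbitrary, whence the norm. *)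
exists `|M| => x; apply: sup_norm_le => [|i]; first by rewrite mulr_ge0.
rewrite (le_trans (family_val_le i x))// ler_wpM2r// real_ler_norm//.
by rewrite ger0_real// (le_trans _ (gM i)).
Qed.

Definition family_operator : operator X (linfty I : normedModType K) :=
  Operator family_bounded_linear.

(** The functional [g i] is the image under the adjoint of the evaluation at
[i], which has norm at most 1. *)
Lemma le_bidual_family_operator (F : dual (dual X)) i :
  `|F (g i)| <= `|adjoint (adjoint family_operator) F|.
Proof.
have -> : g i = adjoint family_operator (linfty_eval i).
  exact/val_inj/funext.
rewrite -[F _]/(adjoint (adjoint family_operator) F (linfty_eval i)).
rewrite (le_trans (le_op_norm _ _))// ler_piMr ?op_norm_ge0//.
exact: linfty_eval_norm.
Qed.

End BoundedFamily.

(** * Right sets and Dunford-Pettis convergent operators *)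

Section RightSets.
Context {R : realType} {s : scalars} (p : R).
Local Notation K := (scalar_field R s).

(** For [g] in the unit ball, [adjoint T g] maps [x n] to [g (T (x n))], whose
modulus is at most [`|T (x n)|]. *)
Lemma adjoint_unit_ball_Right_set (X Y : normedModType K) (T : operator X Y) :
  Dunford_Pettis_convergent p T ->
  Right_set p (adjoint T @` [set g | `|g| <= 1]).
Proof.
move=> Tp; have T1 (x : X) (f : dual X) :
    (adjoint T @` [set g | `|g| <= 1]) f -> `|f x| <= `|T x|.
  move=> [g /= g1 <-]; rewrite adjointE (le_trans (le_op_norm _ _))//.
  exact: ler_piMl.
split.
  apply/bounded_setP; exists (op_norm (adjoint T)) => _ [g /= g1 <-].
  apply: le_trans (le_op_norm (adjoint T) g) _.
  by rewrite ler_piMr// op_norm_ge0.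
move=> x /Tp; apply: squeeze_norm0 => n; rewrite normr_id.
rewrite ger0_norm; first by apply: supremum_norm_le => //; exact: T1.
by apply: supremum_norm_ge0; exact: T1.
Qed.

(** The supremum over the image of the unit ball is the operator norm of
[adjoint S (F n)], by the definition of that norm. *)
Lemma Right_star_image_unit_ball (Z V : normedModType K) (S : operator V Z) :
  Right_star_set p (S @` [set g | `|g| <= 1]) ->
  Dunford_Pettis_convergent p (adjoint S).
Proof.
move=> [_ Sp] F /Sp; apply: squeeze_norm0 => n.
rewrite normr_id [X in _ <= `|X|](_ : _ = `|adjoint S (F n)|) ?normr_id//.
by rewrite image_comp.
Qed.

(** The sup norm of [family_operator x] is the supremum that a Right set
controls. *)
Lemma family_operator_Dunford_Pettis (X : normedModType K) (A : set (dual X))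
    (M : K) (AM : forall f : A, `|\val f| <= M) :
  Right_set p A -> Dunford_Pettis_convergent p (family_operator _ _ AM).
Proof.
move=> [_ Ap] x /Ap; apply: squeeze_norm0 => n; rewrite normr_id.
have xM f : A f -> `|f (x n)| <= M * `|x n|.
  by move=> Af; exact: (family_val_le _ _ AM (SigSub (mem_set Af)) (x n)).
rewrite [leRHS]ger0_norm; last exact: supremum_norm_ge0 xM.
apply: sup_norm_le => [|f]; first exact: supremum_norm_ge0 xM.
by apply: (le_supremum_norm _ _ _ _ xM); exact: set_valP.
Qed.

Lemma Right_star_set_family_operator (X : normedModType K) (A : set (dual X))
    (M : K) (AM : forall f : A, `|\val f| <= M) :
  Dunford_Pettis_convergent p (adjoint (adjoint (family_operator _ _ AM))) ->
  Right_star_set p A.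
Proof.
have AM' (f : dual X) : A f -> `|f| <= M.
  by move=> Af; exact: (AM (SigSub (mem_set Af))).
move=> Tp; split; first by apply/bounded_setP; exists M.
move=> F /Tp; apply: squeeze_norm0 => n; rewrite normr_id.
have FT f : A f ->
    `|F n f| <= `|adjoint (adjoint (family_operator _ _ AM)) (F n)|.
  by move=> Af; exact: (le_bidual_family_operator _ _ AM _ (SigSub (mem_set Af))).
rewrite ger0_norm; first exact: supremum_norm_le FT.
exact: supremum_norm_ge0 FT.
Qed.

End RightSets.

Theorem theorem3p3 (R : realType) (s : scalars) (p : R) (hp : 1 <= p)
    (X : completeNormedModType (scalar_field R s)) :
  (forall A : set (dual X), Right_set p A -> Right_star_set p A) <->
  (forall (Y : completeNormedModType (scalar_field R s)) (T : operator X Y),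
     Dunford_Pettis_convergent p T ->
     Dunford_Pettis_convergent p (adjoint (adjoint T))).
Proof.
split=> [XR Y T Tp|XD A Ap].
  exact/Right_star_image_unit_ball/XR/adjoint_unit_ball_Right_set.
have [M AM] := (bounded_setP A).1 Ap.1.
have {}AM (f : A) : `|\val f| <= M by apply: AM; exact: set_valP.
apply: (@Right_star_set_family_operator _ _ _ _ _ M AM).
exact/XD/family_operator_Dunford_Pettis.
Qed.
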